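(* Let $G=(V,E)$ be a graph, $R=\{r_1,\dots,r_t\}$ a multiset of vertices of $V$, and $\mathcal{M}$ a matroid on $R$ of rank $k$ with rank function $r_{\mathcal{M}}:2^{R}\to\mathbb{Z}$. Then $(G,R)$ can be decomposed into rooted-components $(C_1,r_1),\dots,(C_t,r_t)$ such that the multiset $\{r_i\in R\mid v\in V(C_i,r_i)\}$ is a spanning set of $\mathcal{M}$ for every $v\in V$ if and only if $$|\delta_G(\mathcal{P})|\ \ge\ k|\mathcal{P}|-\sum_{X\in\mathcal{P}} r_{\mathcal{M}}(R_X)$$ for every partition $\mathcal{P}$ of $V$ into non-empty subsets.
   Context: Graphs are finite and undirected. For $F\subseteq E$, $V(F)$ is the set of vertices incident to edges of $F$. The multiset $R=\{r_1,\dots,r_t\}$ is regarded as a family indexed by $1,\dots,t$ (different indices are different elements of $R$); a matroid on $R$ has these $t$ elements as ground set. For $X\subseteq V$, $R_X=\{r_i\in R\mid r_i\in X\}$ as a multi-subset. A pair $(C,r)$ with $C\subseteq E$, $r\in V$ is a rooted-component if either $C=\emptyset$, or $C$ is connected and $r\in V(C)$. Put $V(C,r)=V(C)\cup\{r\}$. A decomposition of $(G,R)$ into rooted-components $(C_1,r_1),\dots,(C_t,r_t)$ means that $C_1,\dots,C_t$ are pairwise disjoint with union $E$ (empty $C_i$ allowed) and each $(C_i,r_i)$ is a rooted-component. For a partition $\mathcal{P}$ of $V$, $|\mathcal{P}|$ is the number of its parts and $\delta_G(\mathcal{P})$ is the set of edges of $G$ connecting two distinct parts of $\mathcal{P}$.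 A spanning set of $\mathcal{M}$ is a set whose rank equals the rank of $\mathcal{M}$.
   Formalization: The rank k of the matroid is assumed positive: for k = 0 the equivalence fails, e.g. for one edge ab, an isolated vertex c, R = {c} and a rank-0 matroid, where the inequality holds but the edge ab lies in no rooted-component. *)

(* Defs.v *)
From HB Require Import structures.
From mathcomp Require Import all_boot all_order all_algebra.

Set Implicit Arguments.
Unset Strict Implicit.
Unset Printing Implicit Defensive.

Import Order.TTheory GRing.Theory Num.Theory.

(* Parallel edges are distinct elements of [edge] with the same end set; a loop
   is an edge whose end set is a singleton. *)
Record mgraph := MGraph {
  vertex : finType;
  edge : finType;
  ends : edge -> {set vertex};
  ends_card : forall e, 0 < #|ends e| <= 2
}.

Section Graph.

Variable G : mgraph.
Implicit Types (F C : {set edge G}) (r u v : vertex G).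

Definition edge_verts F : {set vertex G} := \bigcup_(e in F) ends e.

Definition edge_adj F : rel (vertex G) :=
  fun u v => [exists e in F, (u \in ends e) && (v \in ends e)].

Definition edge_connected F : Prop :=
  {in edge_verts F &, forall u v, connect (edge_adj F) u v}.

Definition rooted_component C r : Prop :=
  C = set0 \/ edge_connected C /\ r \in edge_verts C.

Definition rooted_verts C r : {set vertex G} := edge_verts C :|: [set r].

Definition rooted_decomposition t (R : 'I_t -> vertex G)
    (C : 'I_t -> {set edge G}) : Prop :=
  [/\ forall i j, i != j -> [disjoint C i & C j],
      \bigcup_i C i = [set: edge G]
    & forall i, rooted_component (C i) (R i)].

Definition delta (P : {set {set vertex G}}) : {set edge G} :=
  [set e | [exists X in P, exists Y in P,
     [&& X != Y, ends e :&: X != set0 & ends e :&: Y != set0]]].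

(* A multiset of [t] vertices is a family [R : 'I_t -> vertex G]; its
   sub-multisets are sets of indices. *)
Definition roots_in t (R : 'I_t -> vertex G) (X : {set vertex G}) : {set 'I_t} :=
  [set i | R i \in X].

End Graph.

Record matroid (T : finType) := Matroid {
  indep : pred {set T};
  indep_set0 : indep set0;
  indep_sub : forall I J : {set T}, I \subset J -> indep J -> indep I;
  indep_aug : forall I J : {set T}, indep I -> indep J -> #|I| < #|J| ->
    exists2 x, x \in J :\: I & indep (x |: I)
}.

Definition mrank (T : finType) (M : matroid T) (A : {set T}) : nat :=
  \max_(I : {set T} | (I \subset A) && indep M I) #|I|.

Definition spanning (T : finType) (M : matroid T) (A : {set T}) : Prop :=
  mrank M A = mrank M [set: T].

(* Main.v *)
(** Necessity counts, for each component, the parts it enters from outside: it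
    needs an edge of [delta P] for each of them, and for a part [X] the roots in
    [X] together with the components entering [X] span [M].

    Sufficiency: let every root be present at its own vertex. A polymatroid-type
    uncrossing argument turns the partition condition into a vector [m] (the
    indegrees of an orientation) with [m(X) - i(X) >= k - r(roots on X)] for every
    non-empty [X]. While the roots present at some vertex do not span, an edge
    [uw] is deleted, [m w] is lowered by one, and a root present at [u] and not in
    the closure of those at [w] becomes present at [w] too; uncrossing of tight
    sets provides an edge and a root for which the inequalities persist. *)
Require Import Defs.
From mathcomp Require Import all_boot all_order all_algebra.
From mathcomp Require Import zify.
Import Order.TTheory GRing.Theory Num.Theory.

(** * Rank and closure *)

Section MatroidRank.

Set Implicit Arguments.
Unset Strict Implicit.
Variables (T : finType) (M : matroid T).
Implicit Types (A B I J : {set T}) (x : T).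
Local Notation r := (mrank M).

Lemma indep_leq_mrank I A : I \subset A -> indep M I -> #|I| <= r A.
Proof.
by move=> sIA iI; apply: (bigop.bigmax_sup I) => //; rewrite sIA.
Qed.

(** A maximal independent set between [I] and [A] has full rank, since a larger independent subset
    of [A] would augment it. *)
Lemma mrank_basis_ext I A : I \subset A -> indep M I ->
  exists2 J : {set T}, I \subset J /\ J \subset A & indep M J /\ #|J| = r A.
Proof.
move=> sIA iI.
have [B /andP[sBA iB] rB] : exists2 B : {set T}, (B \subset A) && indep M B & r A = #|B|.
  have P0 : (set0 \subset A) && indep M set0 by rewrite sub0set indep_set0.
  rewrite /mrank (bigop.bigmax_eq_arg set0) //; by case: arg_maxnP => // B PB _; exists B.
pose ext : pred {set T} := fun J => [&& I \subset J, J \subset A & indep M J].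
have PI : ext I by rewrite /ext subxx sIA.
have [J /maxsetP[/and3P[sIJ sJA iJ] maxJ] _] := maxset_exists PI.
exists J => //; split=> //; apply/eqP; rewrite eqn_leq indep_leq_mrank //= rB.
rewrite leqNgt; apply/negP=> /(indep_aug iJ iB)[x /setDP[xB xJ] iJx].
case/negP: xJ; rewrite -(maxJ (x |: J)) ?setU11 ?subsetUr //.
by rewrite /ext iJx subUset sub1set (subsetP sBA) // sJA (subset_trans sIJ) ?subsetUr.
Qed.

Lemma mrank_basis A : exists2 J : {set T}, J \subset A & indep M J /\ #|J| = r A.
Proof.
by have [J [_ sJA] JP] := mrank_basis_ext (sub0set A) (indep_set0 M); exists J.
Qed.

Lemma mrank_sub A B : A \subset B -> r A <= r B.
Proof.
move=> sAB; have [J sJA [iJ <-]] := mrank_basis A.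
by apply: indep_leq_mrank => //; apply: subset_trans sAB.
Qed.

Lemma mrank_le_card A : r A <= #|A|.
Proof. by have [J sJA [_ <-]] := mrank_basis A; apply: subset_leq_card. Qed.

(** A basis [I] of [A :&: B] extends to a basis [J] of the union; [J :&: A] and [J :&: B] are
    independent and overlap in at least [I]. *)
Lemma mrank_submod A B : r (A :|: B) + r (A :&: B) <= r A + r B.
Proof.
have [I sI [iI <-]] := mrank_basis (A :&: B).
have sIU : I \subset A :|: B.
  by rewrite (subset_trans sI) // subIset // subsetUl.
have [J [sIJ sJ] [iJ <-]] := mrank_basis_ext sIU iI.
have le C : #|J :&: C| <= r C.
  by apply: indep_leq_mrank; [apply: subsetIr | apply: indep_sub iJ; apply: subsetIl].
apply: leq_trans (leq_add (le A) (le B)); rewrite -(cardsUI (J :&: A)) -setIUr.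
rewrite (setIidPl sJ) leq_add2l subset_leq_card //.
by rewrite -setIIr subsetI sIJ.
Qed.

(** * Closure operator *)

Definition closure A : {set T} := [set x | r (x |: A) == r A].

Lemma in_closure x A : (x \in closure A) = (r (x |: A) <= r A).
Proof. by rewrite inE eqn_leq [X in _ && X]mrank_sub ?andbT ?subsetUr. Qed.

Lemma sub_closure A : A \subset closure A.
Proof. by apply/subsetP=> x xA; rewrite in_closure (setUidPr _) // sub1set. Qed.

(** An augmenting element taken from a larger independent subset of the closure would raise the rank
    of [A]. *)
Lemma mrank_closure A : r (closure A) = r A.
Proof.
apply/eqP; rewrite eqn_leq [X in _ && X]mrank_sub ?sub_closure // andbT leqNgt.
have [I sIA [iI rI]] := mrank_basis A.
have [J sJ [iJ rJ]] := mrank_basis (closure A).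
apply/negP; rewrite -rI -rJ => lt.
have [x /setDP[xJ xI] ixI] := indep_aug iI iJ lt.
have := subsetP sJ _ xJ; rewrite in_closure -rI; apply/negP; rewrite -ltnNge.
have : #|x |: I| <= r (x |: A) by apply: indep_leq_mrank; rewrite ?setUS.
by rewrite cardsU1 xI.
Qed.

Lemma closureS A B : A \subset B -> closure A \subset closure B.
Proof.
move=> sAB; apply/subsetP=> x; rewrite !in_closure => rx.
have := mrank_submod (x |: A) B; rewrite -setUA (setUidPr sAB).
have : r A <= r ((x |: A) :&: B) by rewrite mrank_sub // subsetI subsetUr.
lia.
Qed.

Lemma closure_sub A B : A \subset closure B -> closure A \subset closure B.
Proof.
move=> /closureS sAB; apply/subsetP=> x /(subsetP sAB).
rewrite !in_closure mrank_closure; apply: leq_trans.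
by rewrite mrank_sub // setUS // sub_closure.
Qed.

Lemma closure_mrank_eq A B : A \subset B -> r B <= r A -> closure B \subset closure A.
Proof.
move=> sAB rBA; apply/subsetP=> x; rewrite !in_closure => rx.
by rewrite (leq_trans (leq_trans _ rx) rBA) // mrank_sub // setUS.
Qed.

End MatroidRank.

(** * Tight sets and growth *)

Section Decomposition.

Set Implicit Arguments.
Unset Strict Implicit.
Variables (G : mgraph) (I : finType) (M : matroid I) (k : nat).
Implicit Types (F D : {set edge G}) (u v w : vertex G) (X Y Z : {set vertex G}).
Implicit Types (m : {ffun vertex G -> nat}) (B : vertex G -> {set I}) (i s : I).
Local Notation r := (mrank M).

(* [B v] is the set of roots present at [v]; a root may be present at several
   vertices, which stands for adding parallel copies of it to the matroid. *)
Definition roots_on B X : {set I} := \bigcup_(v in X) B v.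

Definition inner F X : {set edge G} := [set e in F | ends e \subset X].

(* In an orientation of [F] with indegree vector [m], the set [X] is entered by
   [\sum_(v in X) m v - #|inner F X|] arcs. *)
Definition feasible F m B : Prop := forall X, X != set0 ->
  #|inner F X| + k <= \sum_(v in X) m v + r (roots_on B X).

Definition tight F m B X : bool :=
  (X != set0) && (#|inner F X| + k == \sum_(v in X) m v + r (roots_on B X)).

Lemma roots_onS B X Y : X \subset Y -> roots_on B X \subset roots_on B Y.
Proof.
by move=> sXY; apply/bigcupsP=> v vX; apply: bigcup_sup; apply: (subsetP sXY).
Qed.

Lemma roots_on_sup B X v : v \in X -> B v \subset roots_on B X.
Proof. exact: bigcup_sup. Qed.

Lemma inner_supermod F X Y :
  #|inner F X| + #|inner F Y| <= #|inner F (X :|: Y)| + #|inner F (X :&: Y)|.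
Proof.
rewrite -cardsUI leq_add ?subset_leq_card //; last first.
  by apply/subsetP=> e; rewrite !inE subsetI => /andP[/andP[-> ->] /andP[_ ->]].
apply/subsetP=> e; rewrite !inE => /orP[] /andP[-> sX] /=; apply: subset_trans sX _.
  exact: subsetUl.
exact: subsetUr.
Qed.

Lemma sum_setUI m X Y : \sum_(v in X) m v + \sum_(v in Y) m v =
  \sum_(v in X :|: Y) m v + \sum_(v in X :&: Y) m v.
Proof.
rewrite (big_setID X (A := X :|: Y)) /= setUK -addnA; congr (_ + _).
by rewrite setDUl setDv set0U (big_setID X (A := Y)) /= setIC addnC.
Qed.

(** Sums are modular, [inner] is supermodular and rank submodular, so tightness of both sets forces
    equality throughout. Submodularity is applied to the closures, so that [A :&: A'] gets the rank
    of the roots on [X :&: Y]. *)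
Lemma tight_uncross F m B X Y : feasible F m B ->
    tight F m B X -> tight F m B Y -> X :&: Y != set0 ->
  [/\ tight F m B (X :|: Y), tight F m B (X :&: Y)
    & closure M (roots_on B X) :&: closure M (roots_on B Y)
        \subset closure M (roots_on B (X :&: Y))].
Proof.
move=> fF /andP[X0 /eqP tX] /andP[Y0 /eqP tY] XY0.
have U0 : X :|: Y != set0 by rewrite setU_eq0 negb_and X0.
have := fF _ U0; have := fF _ XY0; have := sum_setUI m X Y.
have := inner_supermod F X Y.
rewrite /tight U0 XY0 /=.
set A := closure M _; set A' := closure M _.
have := mrank_submod M A A'; rewrite !mrank_closure.
have : r (roots_on B (X :|: Y)) <= r (A :|: A').
  by rewrite /roots_on bigcup_setU mrank_sub // setUSS // sub_closure.
have sI : roots_on B (X :&: Y) \subset A :&: A'.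
  by rewrite subsetI !(subset_trans _ (sub_closure _ _)) // roots_onS ?subsetIl ?subsetIr.
have := mrank_sub M sI => h1 h2 h3 h4 h5 h6 h7.
split; first lia; first lia.
apply: subset_trans (sub_closure _ _) _; apply: closure_mrank_eq => //; lia.
Qed.

(** * Minimal indegree vectors *)

Definition decr m v : {ffun vertex G -> nat} := [ffun w => m w - (w == v)].

Lemma sum_decr m v X : 0 < m v ->
  \sum_(w in X) decr m v w + (v \in X) = \sum_(w in X) m w.
Proof.
move=> mv; have [vX|vX] := boolP (v \in X); last first.
  rewrite addn0; apply: eq_bigr => w wX; rewrite ffunE.
  by case: eqP => [wv|]; [rewrite -wv wX in vX | rewrite subn0].
rewrite (big_setD1 v) //= [RHS](big_setD1 v) //= ffunE eqxx addnAC subnK //; congr (_ + _).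
by apply: eq_bigr => w /setD1P[wv _]; rewrite ffunE (negPf wv) subn0.
Qed.

(** Lowering [m] at a vertex in no tight set keeps every inequality; the total drops, so this
    stops. *)
Lemma exists_tightening F m B : (forall v, r (B v) <= k) -> feasible F m B ->
  exists2 m', feasible F m' B
            & forall v, exists2 X : {set vertex G}, v \in X & tight F m' B X.
Proof.
move=> rB; have [n] := ubnP (\sum_(v in [set: vertex G]) m v).
elim: n m => // n IH m ltn fm.
have [/forallP h|] :=
  boolP [forall v, exists X : {set vertex G}, (v \in X) && tight F m B X].
  by exists m => // v; have /existsP[X /andP[]] := h v; exists X.
rewrite negb_forall => /existsP[v]; rewrite negb_exists => /forallP notight.
(* If [m v] were zero, feasibility and the bound on [r (B v)] would make [[set v]] tight. *)
have mv : 0 < m v.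
  rewrite lt0n; apply/negP=> /eqP mv0; have := notight [set v].
  have v0 : [set v] != set0 by apply/set0Pn; exists v; rewrite inE.
  have := fm _ v0; rewrite inE eqxx /tight v0 /= /roots_on !big_set1 mv0 => le.
  rewrite eqn_leq le /= => /negP; apply.
  by apply: leq_trans (rB v) (leq_addl _ _).
apply: (IH (decr m v)).
  by move: ltn; rewrite -(sum_decr setT mv) inE addn1 ltnS.
move=> X X0; have := fm X X0; have := notight X; rewrite /tight X0 /=.
rewrite -(sum_decr X mv); case: (v \in X) => /=; last by rewrite addn0.
rewrite addn1 addSn => neq le; move: (le); rewrite leq_eqVlt (negPf neq).
by rewrite ltnS.
Qed.

(** An edge can lie inside only the part that contains a chosen end [v], and then it joins no two
    parts; so it is counted at most once. *)
Lemma delta_inner (P : {set {set vertex G}}) : partition P setT ->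
  #|delta P| + \sum_(X in P) #|inner setT X| <= #|edge G|.
Proof.
move=> PT; have cP := cover_partition PT; have /and3P[_ tP _] := PT.
have cardE (S : {set edge G}) : #|S| = \sum_e (e \in S).
  by rewrite -sum1_card big_mkcond; apply: eq_bigr => e _; case: (e \in S).
under eq_bigr do rewrite cardE.
rewrite cardE exchange_big -big_split /= -sum1_card; apply: leq_sum => e _.
have /andP[/card_gt0P[v ve] _] := ends_card e.
have vP : v \in cover P by rewrite cP inE.
rewrite (bigD1 (pblock P v)) ?pblock_mem //=.
have -> : \sum_(X in P | X != pblock P v) (e \in inner setT X) = 0.
  apply: big1 => X /andP[XP neX]; rewrite !inE /=; apply/eqP; rewrite eqb0.
  by apply: contra neX => /subsetP/(_ v ve) vX; rewrite (def_pblock tP XP vX).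
rewrite addn0 [e \in inner _ _]inE in_setT /=.
case: (boolP (ends e \subset _)) => [sub|_]; last by case: (e \in delta P).
rewrite inE addn1 ltnS leqn0 eqb0; apply/existsP=> -[X /andP[XP /existsP[Y /and4P[YP]]]].
move=> neXY /set0Pn[x /setIP[xe xX]] /set0Pn[y /setIP[ye yY]]; case/eqP: neXY.
rewrite -(def_pblock tP XP xX) -(def_pblock tP YP yY).
by rewrite !(same_pblock tP (subsetP sub _ _)).
Qed.

(** By uncrossing, the maximal tight sets of a tightened vector form a partition [P]. Summing their
    equalities and applying the hypothesis to [P] bounds the total. *)
Lemma exists_indegree B : (forall v, r (B v) <= k) ->
    (forall P : {set {set vertex G}}, partition P setT ->
       k * #|P| <= #|delta P| + \sum_(X in P) r (roots_on B X)) ->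
  exists2 m, feasible setT m B & \sum_(v in [set: vertex G]) m v <= #|edge G|.
Proof.
(* A single vertex already supplies [#|edge G| + k], which is enough for any set. *)
move=> rB hP; pose m0 : {ffun vertex G -> nat} := [ffun=> #|edge G| + k].
have [|m fm tm] := @exists_tightening setT m0 B rB.
  move=> X /set0Pn[v vX]; rewrite (big_setD1 v) //= ffunE -!addnA.
  by rewrite leq_add ?max_card // leq_addr.
exists m => //.
pose P : {set {set vertex G}} := [set X | maxset (tight setT m B) X].
have tP : trivIset P.
  apply/trivIsetP=> X Y; rewrite !inE => /maxsetP[tX mX] /maxsetP[tY mY].
  apply: contraNT; rewrite -setI_eq0 => XY0.
  have [tU _ _] := tight_uncross fm tX tY XY0.
  by rewrite -(mX _ tU (subsetUl _ _)) (mY _ tU (subsetUr _ _)).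
have cP : cover P = setT.
  apply/setP=> v; rewrite inE; have [X vX tX] := tm v.
  have [Y mY sXY] := maxset_exists tX.
  by apply/bigcupP; exists Y; rewrite ?inE // (subsetP sXY).
have PT : partition P setT.
  rewrite /partition cP eqxx tP /=; apply/negP; rewrite inE => /maxsetp.
  by rewrite /tight eqxx.
rewrite -{1}cP (big_trivIset _ tP) /=.
have eqP : \sum_(X in P) \sum_(v in X) m v + \sum_(X in P) r (roots_on B X) =
           \sum_(X in P) #|inner setT X| + k * #|P|.
  rewrite mulnC -sum_nat_const -!big_split /=; apply: eq_bigr => X.
  by rewrite inE => /maxsetp /andP[_ /eqP <-].
rewrite -(leq_add2r (\sum_(X in P) r (roots_on B X))) eqP.
apply: leq_trans (leq_add (leqnn _) (hP P PT)) _.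
by rewrite addnA leq_add2r addnC delta_inner.
Qed.

(** * Deleting an edge and copying a root *)

(** Induction on the size of [X]: some edge inside [X] joins [Y], the vertices whose roots lie in
    the closure of [B v], to the rest of [X]; a set blocking this edge yields a smaller [X]. *)
Lemma exists_good_edge F m B X v : r setT <= k -> feasible F m B -> tight F m B X -> v \in X ->
    r (B v) < r (roots_on B X) ->
  exists e u w s, [/\ e \in F, u \in ends e, w \in ends e, s \in B u :\: closure M (B w)
    & forall Z, tight F m B Z -> w \in Z -> u \notin Z -> s \notin closure M (roots_on B Z)].
Proof.
move=> rk fm; have [n] := ubnP #|X|; elim: n X v => // n IH X v ltn tX vX rv.
pose Y := [set w in X | B w \subset closure M (B v)].
have sYX : Y \subset X by apply/subsetP=> w; rewrite inE => /andP[].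
have vY : v \in Y by rewrite inE vX sub_closure.
have rY : r (roots_on B Y) <= r (B v).
  rewrite -(mrank_closure M (B v)) mrank_sub //; apply/bigcupsP=> w.
  by rewrite inE => /andP[].
have W0 : X :\: Y != set0.
  apply/negP=> /eqP/eqP; rewrite setD_eq0 => sXY.
  by move: rv; rewrite ltnNge (leq_trans _ rY) // mrank_sub // roots_onS.
have Y0 : Y != set0 by apply/set0Pn; exists v.
have rW : r (roots_on B (X :\: Y)) <= k.
  by apply: leq_trans rk; rewrite mrank_sub // subsetT.
(* Otherwise the inequalities for [Y] and [X :\: Y] add up to contradict tightness of [X], as the
   roots on [Y] have smaller rank than those on [X] and the others have rank at most [k]. *)
have : ~~ (inner F X \subset inner F Y :|: inner F (X :\: Y)).
  apply/negP=> /subset_leq_card; have := cardsUI (inner F Y) (inner F (X :\: Y)).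
  have := fm _ Y0; have := fm _ W0; have /andP[_ /eqP] := tX.
  rewrite (big_setID Y (A := X)) /= (setIidPr sYX); lia.
case/subsetPn=> e; rewrite !inE => /andP[eF seX]; rewrite eF negb_or /=.
case/andP=> /subsetPn[u ue uY] neW.
have uX := subsetP seX _ ue.
have [w we wY] : exists2 w, w \in ends e & w \in Y.
  case/subsetPn: neW => w we; rewrite inE (subsetP seX _ we) andbT negbK.
  by exists w.
move: uY; rewrite inE uX /= => /subsetPn[s su sv].
have /andP[wX Bw] : (w \in X) && (B w \subset closure M (B v)) by rewrite inE in wY.
have sw : s \notin closure M (B w).
  by apply: contra sv; apply/subsetP/closure_sub.
case: (boolP [exists Z, [&& tight F m B Z, w \in Z, u \notin Z
                         & s \in closure M (roots_on B Z)]]); last first.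
  rewrite negb_exists => /forallP nb; exists e, u, w, s; split=> //; first by rewrite inE sw.
  by move=> Z tZ wZ uZ; have := nb Z; rewrite tZ wZ uZ.
(* A tight set [Z] blocking the candidate can be replaced by [X :&: Z], which is
   smaller as it misses [u]. *)
case/existsP=> Z /and4P[tZ wZ uZ sZ].
have XZ0 : X :&: Z != set0 by apply/set0Pn; exists w; rewrite inE wX.
have [_ tI sub] := tight_uncross fm tX tZ XZ0.
apply: (IH (X :&: Z) w) => //; last 2 first.
- by rewrite inE wX.
(* [s] is in the closures of the roots on [X] and on [Z], hence on [X :&: Z], but not in that of
   [B w]. *)
- rewrite ltnNge; apply: contra sw => le.
  apply: (subsetP (closure_mrank_eq (roots_on_sup B _) le)); first by rewrite inE wX.
  apply: (subsetP sub); rewrite inE sZ andbT; apply: (subsetP (sub_closure _ _)).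
  exact: subsetP (roots_on_sup B uX) _ su.
- rewrite -ltnS (leq_trans _ ltn) // ltnS proper_card // properE subsetIl /=.
  by apply/subsetPn; exists u; rewrite // inE uX.
Qed.

Definition add_root B w s : vertex G -> {set I} :=
  fun x => if x == w then s |: B x else B x.

Lemma roots_on_addS B w s X : roots_on B X \subset roots_on (add_root B w s) X.
Proof.
apply/bigcupsP=> x xX; apply: subset_trans (roots_on_sup _ xX).
by rewrite /add_root; case: eqP => // _; apply: subsetUr.
Qed.

Lemma roots_on_add B w s X : w \in X ->
  s |: roots_on B X \subset roots_on (add_root B w s) X.
Proof.
move=> wX; rewrite subUset roots_on_addS andbT sub1set; apply/bigcupP.
by exists w; rewrite // /add_root eqxx setU11.
Qed.

(** Only a set containing [w] but not [u] loses a unit of [m] without losing an inner edge. If it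
    was tight, [s] raises its rank; otherwise it had slack. *)
Lemma feasible_transfer F m B e u w s : feasible F m B ->
    e \in F -> ends e = [set u; w] -> 0 < m w ->
    (forall Z, tight F m B Z -> w \in Z -> u \notin Z ->
       s \notin closure M (roots_on B Z)) ->
  feasible (F :\ e) (decr m w) (add_root B w s).
Proof.
move=> fm eF ends_e mw good X X0; have := fm X X0; rewrite -(sum_decr X mw).
have -> : inner (F :\ e) X = inner F X :\ e.
  by apply/setP=> x; rewrite !inE andbA.
have := mrank_sub M (roots_on_addS B w s X).
rewrite (cardsD1 e (inner F X)) [e \in _]inE eF ends_e subUset !sub1set /=.
have [wX|wX] := boolP (w \in X); last first.
  by rewrite andbF addn0 => le /leq_trans; apply; rewrite leq_add2l.
have [uX|uX] := boolP (u \in X) => /=.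
  move=> le; rewrite add1n addn1 !addSn ltnS => /leq_trans; apply.
  by rewrite leq_add2l.
move=> le; rewrite add0n => le'; rewrite leqNgt; apply/negP=> lt.
have eq : #|inner F X :\ e| + k = \sum_(v in X) decr m w v + 1 + r (roots_on B X).
  apply/eqP; rewrite eqn_leq le' /= addnAC addn1 (leq_trans _ lt) // ltnS.
  by rewrite leq_add2l.
have tX : tight F m B X.
  rewrite /tight X0 -(sum_decr X mw) wX -eq eqn_add2r.
  rewrite (cardsD1 e (inner F X)) [e \in _]inE eF ends_e subUset !sub1set.
  by rewrite (negPf uX) add0n eqxx.
have := good _ tX wX uX; rewrite in_closure -ltnNge => /leq_trans.
move=> /(_ _ (mrank_sub M (roots_on_add B s wX))); rewrite ltnNge => /negP; apply.
by move: lt; rewrite eq addnAC addn1 ltnS leq_add2l.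
Qed.

(** * Growing the components *)

Lemma edge_adj_sym D : symmetric (edge_adj D).
Proof. by move=> u v; apply: eq_existsb => e; rewrite [X in _ && X]andbC. Qed.

Lemma connect_adjS D D' u v : D \subset D' ->
  connect (edge_adj D) u v -> connect (edge_adj D') u v.
Proof.
move=> sD; apply: connect_sub => x y /existsP[e /and3P[eD xe ye]].
by apply: connect1; apply/existsP; exists e; rewrite (subsetP sD) // xe.
Qed.

(** Several starts are allowed because copies of [i] may be present at several vertices during the
    growth. *)
Definition reach B D i v : bool :=
  [exists w, (i \in B w) && connect (edge_adj D) w v].

Lemma sub_reach B D v i : i \in B v -> reach B D i v.
Proof. by move=> iB; apply/existsP; exists v; rewrite iB connect0. Qed.

Lemma reachS B D D' i v : D \subset D' -> reach B D i v -> reach B D' i v.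
Proof.
move=> sD /existsP[w /andP[iw c]]; apply/existsP; exists w.
by rewrite iw (connect_adjS sD).
Qed.

Lemma reach_edge B D e i u v : e \in D -> u \in ends e -> v \in ends e ->
  reach B D i u -> reach B D i v.
Proof.
move=> eD ue ve /existsP[w /andP[iw c]]; apply/existsP; exists w.
rewrite iw (connect_trans c) // connect1 //.
by apply/existsP; exists e; rewrite eD ue.
Qed.

Lemma exists_growth F m B : r setT = k -> feasible F m B ->
    \sum_(v in [set: vertex G]) m v = #|F| ->
  exists C : I -> {set edge G},
    [/\ forall i, C i \subset F, forall i j, i != j -> [disjoint C i & C j],
        forall v, r [set i | reach B (C i) i v] = k
      & forall i v, v \in edge_verts (C i) -> reach B (C i) i v].
Proof.
move=> rk; have rle A : r A <= k by rewrite -rk mrank_sub ?subsetT.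
have [n] := ubnP #|F|; elim: n F m B => // n IH F m B ltn fm sm.
have [/forallP full|] := boolP [forall v, r (B v) == k].
  exists (fun=> set0); split=> [i|i j _|v|i v].
  - exact: sub0set.
  - by rewrite -setI_eq0 set0I.
  - apply/eqP; rewrite eqn_leq rle -(eqP (full v)) mrank_sub //.
    by apply/subsetP=> i iB; rewrite inE sub_reach.
  - by rewrite /edge_verts big_set0 inE.
rewrite negb_forall => /existsP[v0 rv0].
(* As [m] sums to [#|F|], the roots jointly have rank [k] and the whole vertex set is tight; it
   starts the search for an edge. *)
have T0 : [set: vertex G] != set0 by apply/set0Pn; exists v0; rewrite inE.
have FT : inner F setT = F by apply/setP=> e; rewrite inE subsetT andbT.
have rT : r (roots_on B setT) = k.
  by apply/eqP; rewrite eqn_leq rle; have := fm _ T0; rewrite sm FT leq_add2l.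
have tT : tight F m B setT by rewrite /tight T0 sm FT rT /=.
have lt0 : r (B v0) < r (roots_on B setT) by rewrite rT ltn_neqAle rv0 rle.
have [e [u [w [s [eF ue we /setDP[su sw] good]]]]] :=
  exists_good_edge (eq_leq rk) fm tT (in_setT v0) lt0.
have neuw : u != w.
  by apply: contraNneq sw => <-; apply: subsetP su; apply: sub_closure.
have ends_e : ends e = [set u; w].
  apply/esym/eqP; rewrite eqEcard subUset !sub1set ue we cards2 neuw.
  by have /andP[] := ends_card e.
(* With [m w = 0], feasibility of [[set w]] would make [B w] spanning, but [s] is outside its
   closure. *)
have mw : 0 < m w.
  rewrite lt0n; apply/negP=> /eqP mw0.
  have w0 : [set w] != set0 by apply/set0Pn; exists w; rewrite inE.
  have := fm _ w0; rewrite /roots_on !big_set1 mw0 leqNgt => /negP; apply.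
  move: sw; rewrite in_closure -ltnNge => /leq_trans/(_ (rle _)) lt.
  by rewrite add0n (leq_trans lt) ?leq_addl.
set B' := add_root B w s.
have fm' : feasible (F :\ e) (decr m w) B'.
  by apply: (@feasible_transfer _ _ _ _ u) => // Z tZ wZ uZ; apply: good.
have cardF : #|F| = #|F :\ e| + 1 by rewrite (cardsD1 e) eF addnC.
have [||C [CF dC rC vC]] := IH (F :\ e) (decr m w) B' _ fm'.
- by move: ltn; rewrite cardF addn1.
- by apply/eqP; rewrite -(eqn_add2r 1) -cardF -sm -(sum_decr _ mw) in_setT.
(* The deleted edge goes to the component of the root that it carried. *)
pose C' i := if i == s then e |: C i else C i.
have sC i : C i \subset C' i by rewrite /C'; case: eqP => // _; apply: subsetUr.
have eC : e \in C' s by rewrite /C' eqxx setU11.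
have notC i : e \notin C i by apply/negP=> /(subsetP (CF i)); rewrite !inE eqxx.
(* A start in [B'] but not in [B] is the copy of [s] at [w], which is reached from [u] through
   [e]. *)
have reachE i v : reach B' (C i) i v -> reach B (C' i) i v.
  case/existsP=> x /andP[ix c]; have {}c := connect_adjS (sC i) c.
  have [eix|] := boolP (i \in B x); first by apply/existsP; exists x; rewrite eix.
  move: ix; rewrite /B' /add_root; case: eqP => [xw|_ -> //].
  rewrite in_setU1 => /orP[/eqP eis _|-> //].
  move: c; rewrite eis xw => c; apply/existsP; exists u; rewrite su.
  apply: connect_trans c; rewrite connect1 //; apply/existsP; exists e.
  by rewrite eC ue.
exists C'; split=> [i|i j neij|v|i v].
- rewrite /C'; case: eqP => _; last exact: subset_trans (CF i) (subD1set _ _).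
  by rewrite subUset sub1set eF (subset_trans (CF i) (subD1set _ _)).
- have := dC _ _ neij; rewrite -!setI_eq0 /C'.
  case: (eqVneq i s) neij => [->|_]; case: (eqVneq j s) => [->|_] //.
  + move=> _ /eqP eC0; rewrite setIUl eC0 setU0 setI_eq0 disjoints1 //.
  + move=> _ /eqP eC0; rewrite setIUr eC0 setU0 setIC setI_eq0 disjoints1 //.
- apply/eqP; rewrite eqn_leq rle -(rC v) mrank_sub //.
  by apply/subsetP=> i; rewrite !inE; apply: reachE.
- case/bigcupP=> x; have [xC xv|xC] := boolP (x \in C i).
    by move=> ?; apply/reachE/vC/bigcupP; exists x.
  rewrite /C'; case: eqP xC => [->|_] xC; last by rewrite (negPf xC).
  rewrite in_setU1 (negPf xC) orbF => /eqP-> ve.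
  have -> : e |: C s = C' s by rewrite /C' eqxx.
  by apply: reach_edge eC ue ve _; apply: sub_reach.
Qed.

End Decomposition.

(** * Rooted components *)

Section RootedComponents.

Set Implicit Arguments.
Unset Strict Implicit.
Variable G : mgraph.
Implicit Types (D F : {set edge G}) (u v w : vertex G) (P : {set {set vertex G}}).

Lemma connect_edge_verts D u v : connect (edge_adj D) u v -> u = v \/ u \in edge_verts D.
Proof.
case/connectP=> -[|w p] /= pth ->; [by left | right].
by case/andP: pth => /existsP[e /and3P[eD ue _]] _; apply/bigcupP; exists e.
Qed.

Lemma rooted_componentI D u : {in edge_verts D, forall v, connect (edge_adj D) u v} ->
  rooted_component D u.
Proof.
move=> conn; have [->|/set0Pn[e eD]] := eqVneq D set0; [by left | right; split].
  move=> v w vD wD; apply: connect_trans (conn w wD).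
  by rewrite (sym_connect_sym (edge_adj_sym D)) conn.
have /andP[/card_gt0P[v ve] _] := ends_card e.
have vD : v \in edge_verts D by apply/bigcupP; exists e.
by have [->|] := connect_edge_verts (conn v vD).
Qed.

Lemma connect_rooted_verts D u v : connect (edge_adj D) u v -> v \in rooted_verts D u.
Proof.
rewrite (sym_connect_sym (edge_adj_sym D)) !inE.
by case/connect_edge_verts=> [->|->]; rewrite ?eqxx ?orbT.
Qed.

(** * Sufficiency *)

Lemma exists_rooted_decomposition t (R : 'I_t -> vertex G) (M : matroid 'I_t) k :
    0 < k -> mrank M setT = k ->
    (forall P, partition P setT ->
       k * #|P| <= #|delta P| + \sum_(X in P) mrank M (roots_in R X)) ->
  exists C : 'I_t -> {set edge G}, rooted_decomposition R C /\
    forall v, spanning M [set i | v \in rooted_verts (C i) (R i)].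
Proof.
move=> k0 rk hP; pose B v := [set i | R i == v].
have rle A : mrank M A <= k by rewrite -rk mrank_sub ?subsetT.
have BR X : roots_on B X = roots_in R X.
  apply/setP=> i; rewrite inE; apply/bigcupP/idP => [[v vX]|RX].
    by rewrite inE => /eqP->.
  by exists (R i); rewrite ?inE.
have [||m fm sm] := @exists_indegree G _ M k B.
- by move=> v; apply: rle.
- by move=> P PT; under eq_bigr do rewrite BR; apply: hP.
(* Without vertices there are no roots, so the rank would be zero. *)
have [V0|[v0 _]] := set_0Vmem [set: vertex G].
  have I0 : [set: 'I_t] = set0.
    by apply/setP=> i; have := in_setT (R i); rewrite V0 inE.
  by have := mrank_le_card M setT; rewrite rk I0 cards0 leqNgt k0.
have T0 : [set: vertex G] != set0 by apply/set0Pn; exists v0.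
(* The total is at most [#|edge G|] by choice of [m]; feasibility of the whole vertex set gives the
   converse. *)
have sm' : \sum_(v in [set: vertex G]) m v = #|[set: edge G]|.
  apply/eqP; rewrite eqn_leq cardsT sm /=; have := fm _ T0.
  have -> : inner setT setT = [set: edge G].
    by apply/setP=> e; rewrite !inE subsetT.
  by rewrite cardsT => /leq_trans/(_ (leq_add (leqnn _) (rle _))); rewrite leq_add2r.
have [C [_ dC rC vC]] := exists_growth rk fm sm'.
have reachE D i v : reach B D i v = connect (edge_adj D) (R i) v.
  apply/existsP/idP => [[w /andP[]]|c]; first by rewrite inE => /eqP->.
  by exists (R i); rewrite inE eqxx.
(* As [k > 0], an edge left over by the growth process can be added to some
   component reaching one of its ends. *)
have /fin_all_exists[f fP] e : exists i, exists2 v, v \in ends e & reach B (C i) i v.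
  have /andP[/card_gt0P[v ve] _] := ends_card e.
  have : 0 < #|[set i | reach B (C i) i v]|.
    by apply: leq_trans (mrank_le_card M _); rewrite rC.
  by case/card_gt0P=> i; rewrite inE => iv; exists i, v.
pose L := ~: \bigcup_i C i.
pose C' i := C i :|: [set e in L | f e == i].
have sC i : C i \subset C' i by apply: subsetUl.
have notL i e : e \in C i -> e \notin L.
  by move=> eC; rewrite inE negbK; apply/bigcupP; exists i.
exists C'; split; first split.
- move=> i j neij; apply/pred0P=> e; apply/negP=> /andP[] /=; rewrite !in_setU.
  rewrite ![e \in [set _ in _ | _]]in_set.
  case/orP=> [ei|/andP[eL /eqP fi]] /orP[ej|/andP[eL' /eqP fj]].
  + by rewrite (disjointFr (dC i j neij) ei) in ej.
  + by rewrite (negPf (notL _ _ ei)) in eL'.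
  + by rewrite (negPf (notL _ _ ej)) in eL.
  + by rewrite -fi fj eqxx in neij.
- apply/setP=> e; rewrite inE; apply/bigcupP.
  have [/bigcupP[i _ eC]|eC] := boolP (e \in \bigcup_i C i).
    by exists i => //; apply: subsetP (sC i) _ eC.
  by exists (f e) => //; rewrite !inE eC eqxx orbT.
- move=> i; apply: rooted_componentI => v /bigcupP[e]; rewrite in_setU => /orP[eC|eL] ve.
    rewrite -(reachE (C' i)); apply: reachS (sC i) _; apply: vC.
    by apply/bigcupP; exists e.
  (* A leftover edge has an end reached within [C i] itself, so its attachment does not depend on
     other leftover edges. *)
  have [w we] := fP e; move: (eL); rewrite !inE => /andP[_ /eqP->] r.
  rewrite -(reachE (C' i)); apply: (reach_edge (e := e) _ we ve).
    by rewrite in_setU eL orbT.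
  exact: reachS (sC i) r.
- move=> v; rewrite /spanning rk; apply/eqP; rewrite eqn_leq rle -(rC v) mrank_sub //.
  apply/subsetP=> i; rewrite ![i \in _]in_set reachE => /(connect_adjS (sC i)).
  exact: connect_rooted_verts.
Qed.

(** * Necessity *)

(* Grow a family [W] of parts from the part of [u], adding one edge of
   [F :&: delta P] inside [cover W] with each new part. *)
Lemma card_entered_parts F P u : partition P setT -> rooted_component F u ->
  #|[set X in P | (u \notin X) && (X :&: edge_verts F != set0)]|
    <= #|F :&: delta P|.
Proof.
move=> PT; have cP := cover_partition PT; have /and3P[_ tP _] := PT.
have inP v : v \in cover P by rewrite cP inE.
case=> [->|[conF uF]].
  rewrite (_ : [set X in P | _] = set0) ?cards0 //; apply/setP=> X; rewrite !inE.
  by rewrite /edge_verts big_set0 setI0 eqxx !andbF.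
(* The [.+1] accounts for the part of [u], which costs no edge. *)
pose ok : pred {set {set vertex G}} := fun W =>
  [&& W \subset P, pblock P u \in W & #|W| <= #|inner (F :&: delta P) (cover W)|.+1].
have ok0 : ok [set pblock P u] by rewrite /ok sub1set pblock_mem // inE eqxx cards1.
have [W /maxsetP[/and3P[sWP uW cW] maxW] _] := maxset_exists ok0.
(* By maximality: an edge of [F] leaving [cover W] would lie in [delta P] and let the part of its
   other end join [W]. *)
have closedW v w : v \in cover W -> edge_adj F v w -> w \in cover W.
  case/bigcupP=> X XW vX /existsP[e /and3P[eF ve we]]; apply/negPn/negP=> wW.
  have XP := subsetP sWP _ XW.
  have nYW : pblock P w \notin W.
    by apply: contra wW => YW; apply/bigcupP; exists (pblock P w); rewrite ?mem_pblock.
  case/negP: (nYW); rewrite -(maxW (pblock P w |: W)) ?setU11 ?subsetUr //.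
  have neXY : X != pblock P w by apply: contraNneq nYW => <-.
  have nevw : v != w.
    by apply: contraNneq wW => <-; apply/bigcupP; exists X.
  have ends_e : ends e = [set v; w].
    apply/esym/eqP; rewrite eqEcard subUset !sub1set ve we cards2 nevw.
    by have /andP[] := ends_card e.
  have ed : e \in delta P.
    rewrite inE; apply/existsP; exists X; rewrite XP /=.
    apply/existsP; exists (pblock P w); rewrite pblock_mem // neXY /=.
    apply/andP; split; apply/set0Pn; [exists v | exists w]; rewrite inE ?ve ?we //.
    by rewrite mem_pblock inP.
  have cover' : cover (pblock P w |: W) = pblock P w :|: cover W.
    by rewrite /cover bigcup_setU big_set1.
  rewrite /ok subUset sub1set pblock_mem // sWP inE uW orbT cardsU1 nYW add1n ltnS.
  apply: leq_trans cW _; rewrite cover'; apply: proper_card; rewrite properE.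
  apply/andP; split.
    apply/subsetP=> x; rewrite !in_set => /andP[-> sx] /=.
    exact: subset_trans sx (subsetUr _ _).
  apply/subsetPn; exists e; last first.
    by rewrite inE ends_e !subUset !sub1set (negPf wW) !andbF.
  rewrite inE in_setI eF ed ends_e subUset !sub1set !inE mem_pblock inP /= andbT.
  by apply/orP; right; apply/bigcupP; exists X.
have conW v : v \in edge_verts F -> v \in cover W.
  move=> vF; have /connectP[p pth ->] := conF _ _ uF vF.
  have : u \in cover W by apply/bigcupP; exists (pblock P u); rewrite ?mem_pblock.
  elim: p u pth {uF uW ok ok0 maxW} => //= w p IH x /andP[xw pth] xW.
  by apply: IH pth (closedW _ _ xW xw).
(* Adding the part of [u] to the counted parts cancels the [.+1]. *)
rewrite -ltnS; apply: (@leq_trans #|W|); last first.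
  apply: leq_trans cW _; rewrite ltnS subset_leq_card //.
  by apply/subsetP=> e; rewrite inE => /andP[].
set T := [set X in P | _].
have uT : pblock P u \notin T by rewrite inE mem_pblock inP andbF.
have := cardsU1 (pblock P u) T; rewrite uT add1n => <-; apply: subset_leq_card.
rewrite subUset sub1set uW; apply/subsetP=> X; rewrite inE => /and3P[XP _].
case/set0Pn=> v /setIP[vX /conW /bigcupP[Y YW vY]].
by rewrite -(def_pblock tP XP vX) (def_pblock tP (subsetP sWP _ YW) vY).
Qed.

(** Double counting of the pairs of a part and a component entering it: a part [X] is in at least
    [k - mrank M (roots_in R X)] of them, a component in at most [#|C i :&: delta P|]. *)
Lemma rooted_decomposition_delta t (R : 'I_t -> vertex G) (M : matroid 'I_t) k C P :
    mrank M setT = k -> rooted_decomposition R C ->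
    (forall v, spanning M [set i | v \in rooted_verts (C i) (R i)]) ->
    partition P setT ->
  k * #|P| <= #|delta P| + \sum_(X in P) mrank M (roots_in R X).
Proof.
move=> rk [dC _ rcC] spanC PT; have /and3P[_ tP P0] := PT.
pose entered i (X : {set vertex G}) := (R i \notin X) && (X :&: edge_verts (C i) != set0).
have cardX X : X \in P -> k <= \sum_i entered i X + mrank M (roots_in R X).
  move=> XP; have [X0|[v vX]] := set_0Vmem X; first by rewrite -X0 XP in P0.
  have := spanC v; rewrite /spanning rk => <-.
  have sub : [set i | v \in rooted_verts (C i) (R i)]
      \subset [set i | entered i X] :|: roots_in R X.
    apply/subsetP=> i; rewrite !inE /entered; case: (boolP (R i \in X)) => [|RX].
      by rewrite orbT.
    rewrite orbF /= => /orP[vC|/eqP vR]; last by rewrite -vR vX in RX.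
    by apply/set0Pn; exists v; rewrite inE vX.
  apply: leq_trans (mrank_sub M sub) _.
  apply: leq_trans (leq_trans (leq_addr _ _) (mrank_submod M _ _)) _.
  rewrite leq_add2r (leq_trans (mrank_le_card M _)) // -sum1_card big_mkcond /=.
  by apply: leq_sum => i _; rewrite inE; case: (entered i X).
rewrite mulnC -sum_nat_const; apply: leq_trans (leq_sum _ cardX) _.
rewrite big_split /= leq_add2r exchange_big /=.
apply: (@leq_trans (\sum_i #|C i :&: delta P|)).
  apply: leq_sum => i _; apply: leq_trans (card_entered_parts PT (rcC i)).
  rewrite -sum1_card big_mkcond [X in _ <= X]big_mkcond /=; apply: leq_sum => X _.
  by rewrite inE /entered; case: (X \in P); case: (_ && _).
under eq_bigr do rewrite -sum1_card.
rewrite -partition_disjoint_bigcup; last first.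
  move=> i j /dC; rewrite -!setI_eq0 => /eqP dij.
  by rewrite setIACA dij set0I.
rewrite sum1_card subset_leq_card //; apply/bigcupsP=> i _; exact: subsetIr.
Qed.

End RootedComponents.

(** * The equivalence over the integers *)

Local Open Scope ring_scope.

Theorem theorem5p1 (G : mgraph) (t : nat) (R : 'I_t -> vertex G)
    (M : matroid 'I_t) (k : nat) (hM : mrank M [set: 'I_t] = k)
    (hk : (0 < k)%N) :
  (exists C : 'I_t -> {set edge G},
      rooted_decomposition R C /\
      forall v : vertex G, spanning M [set i | v \in rooted_verts (C i) (R i)])
  <->
  (forall P : {set {set vertex G}}, partition P [set: vertex G] ->
      k%:Z * #|P|%:Z - \sum_(X in P) (mrank M (roots_in R X))%:Z
        <= #|delta P|%:Z).
Proof.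
have natE (P : {set {set vertex G}}) :
    (k%:Z * #|P|%:Z - \sum_(X in P) (mrank M (roots_in R X))%:Z <= #|delta P|%:Z)
    = (k * #|P| <= #|delta P| + \sum_(X in P) mrank M (roots_in R X))%N.
  by rewrite lerBlDr -(big_morph Posz PoszD (erefl 0%:Z)) -PoszM -PoszD.
split=> [[C [dC sC]] P PT | hP].
  by rewrite natE (rooted_decomposition_delta hM dC sC PT).
by apply: exists_rooted_decomposition hk hM _ => P PT; rewrite -natE hP.
Qed.
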